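(* Let $\lambda$ be a partition with 2-core $\bar{\lambda}$ and 2-quotient $(\mu,\nu)$. Then $$\mathrm{He}_{\lambda}(x)=x^{|\bar{\lambda}|}\,R_{\lambda}(x^2)$$ for a monic polynomial $R_\lambda$ of degree $|\mu|+|\nu|$ whose constant coefficient is non-zero and equals $$R_{\lambda}(0)=(-1)^{h_{\lambda}}\frac{H_{\mathrm{odd}}(\lambda)}{H(\bar{\lambda})},\qquad h_{\lambda}=\mathrm{ht}_2(\lambda/\bar{\lambda})+\frac{|\lambda|-|\bar{\lambda}|}{2}.$$
   Context: A partition is a vector $\lambda=(\lambda_1,\dots,\lambda_{\ell(\lambda)})$ of integers with $\lambda_1\ge\dots\ge\lambda_{\ell(\lambda)}>0$; $|\lambda|=\sum_i\lambda_i$ and $\ell(\lambda)$ is its length; $\emptyset$ is the empty partition. The degree vector is $n_\lambda=(n_1,\dots,n_{\ell(\lambda)})$ with $n_i=\lambda_i+\ell(\lambda)-i$, and $\Delta(n_\lambda)=\prod_{i<j}(n_j-n_i)$. The monic Hermite polynomials are $\mathrm{He}_0=1$, $\mathrm{He}_1=x$, $\mathrm{He}_n(x)=x\mathrm{He}_{n-1}(x)-(n-1)\mathrm{He}_{n-2}(x)$ for $n\ge2$. The Wronskian Hermite polynomial is $\mathrm{He}_\lambda=\mathrm{Wr}[\mathrm{He}_{n_1},\dots,\mathrm{He}_{n_{\ell(\lambda)}}]/\Delta(n_\lambda)$ (and $\mathrm{He}_\emptyset=1$). Maya diagrams and 2-core/2-quotient: a Maya diagram is a set $M\subset\mathbb{Z}$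 containing all sufficiently negative integers and only finitely many non-negative integers; its partition $\lambda(M)$ has as parts the positive values among $\#\{n\in\mathbb{Z}\setminus M: n<m\}$, $m\in M$, in non-increasing order. For a partition $\lambda$ let $M_\lambda=\{n<0\}\cup\{n_1,\dots,n_{\ell(\lambda)}\}$ and $M_\lambda+t=\{m+t:m\in M_\lambda\}$ for $t\ge0$. For partitions $\mu,\nu$ and $k\in\mathbb{Z}$ pick $s,s'\ge0$ with $\ell(\nu)+s'-\ell(\mu)-s=k$, put $M=\{2m:m\in M_\mu+s\}\cup\{2m+1:m\in M_\nu+s'\}$ and $\Phi(\mu,\nu,k)=\lambda(M)$ (independent of the choice of $s,s'$). Every partition $\lambda$ is uniquely $\lambda=\Phi(\mu,\nu,k)$ with $k\ge0$; $(\mu,\nu)$ is its 2-quotient and $\bar\lambda=(k,k-1,\dots,1)$ ($\bar\lambda=\emptyset$ if $k=0$) its 2-core. Equivalently, $\bar\lambda$ is obtained from $\lambda$ by repeatedly removing dominoes ($1\times2$ or $2\times1$ rectangles of boxes) from the Young diagram, keeping a Young diagram after each removal, until no removal is possible; $|\lambda|=|\bar\lambda|+2(|\mu|+|\nu|)$. $\mathrm{ht}_2(\lambda/\bar\lambda)$ is the number of vertical dominoes removed in such a sequence of removals from $\lambda$ to $\bar\lambda$ (its parity is independent of the sequence). For a box $(i,j)$ of the Young diagram, its hook length is the number of boxes to its right in row $i$ plus the number below it in column $j$ plus one; $H(\lambda)$ is the product of all hook lengths of $\lambda$ and $H_{\mathrm{odd}}(\lambda)$ the product of the odd hook lengths.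 *)

(* Defs.v *)
From mathcomp Require Import all_boot all_order all_algebra.
Set Implicit Arguments. Unset Strict Implicit. Unset Printing Implicit Defensive.
Import Order.TTheory GRing.Theory Num.Theory.

Definition is_partition (l : seq nat) : bool := sorted geq l && all (leq 1) l.

(* degree vector n_i = lambda_i + l - i  (1-indexed; here index i is 0-based) *)
Definition degvec (l : seq nat) : seq nat :=
  [seq nth 0 l i + size l - i.+1 | i <- iota 0 (size l)].

Local Open Scope ring_scope.

Fixpoint He (n : nat) : {poly rat} :=
  match n with
  | 0 => 1
  | 1 => 'X
  | (m.+1 as p).+1 => 'X * He p - (m.+1)%:R *: He m
  end.

Definition wronskian (s : seq {poly rat}) : {poly rat} :=
  \det (\matrix_(i < size s, j < size s) (nth 0 s j)^`(i)).

Definition Delta (n : seq nat) : rat :=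
  \prod_(i < size n) \prod_(j < size n | (i < j)%N)
     ((nth 0 n j)%:R - (nth 0 n i)%:R).

Definition He_part (l : seq nat) : {poly rat} :=
  let n := degvec l in (Delta n)^-1 *: wronskian [seq He x | x <- n].

Local Close Scope ring_scope.

(* Partition of a Maya diagram M = {n < 0} u F, F a finite (uniq) set of
   non-negative integers: the positive values of #{n notin M : n < m}, m in M,
   sorted non-increasingly.  (Elements m < 0 contribute 0.) *)
Definition maya_part (F : seq nat) : seq nat :=
  sort geq [seq x <- [seq count (fun n => n \notin F) (iota 0 m) | m <- F] | 0 < x].

(* Phi(mu, nu, k) for k >= 0, with the choice s = l(nu), s' = k + l(mu)
   (so that l(nu) + s' - l(mu) - s = k).  The non-negative part of
   M = {2m : m in M_mu + s} u {2m+1 : m in M_nu + s'} is listed explicitly. *)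
Definition Phi (mu nu : seq nat) (k : nat) : seq nat :=
  let s := size nu in let s' := k + size mu in
  maya_part ([seq 2 * m | m <- iota 0 s] ++ [seq 2 * (x + s) | x <- degvec mu]
          ++ [seq (2 * m).+1 | m <- iota 0 s'] ++ [seq (2 * (x + s')).+1 | x <- degvec nu]).

Definition staircase (k : nat) : seq nat := [seq k - i | i <- iota 0 k].

(* hook length of box (i,j) (0-based), j < lambda_i *)
Definition hook (l : seq nat) (i j : nat) : nat :=
  (nth 0 l i - j.+1) + (count (fun x => j < x) l - i.+1) + 1.

Definition Hprod (l : seq nat) : nat :=
  \prod_(i < size l) \prod_(j < nth 0 l i) hook l i j.

Definition Hodd (l : seq nat) : nat :=
  \prod_(i < size l) \prod_(j < nth 0 l i | odd (hook l i j)) hook l i j.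

Definition rm0 (l : seq nat) : seq nat := [seq x <- l | 0 < x].

(* b is obtained from the partition a by removing a horizontal domino
   (last two boxes of a row), leaving a Young diagram *)
Definition hdom (a b : seq nat) : bool :=
  is_partition b &&
  has (fun i => (1 < nth 0 a i) && (b == rm0 (set_nth 0 a i (nth 0 a i - 2))))
      (iota 0 (size a)).

(* b is obtained from a by removing a vertical domino (last boxes of rows
   i, i+1 in the same column), leaving a Young diagram *)
Definition vdom (a b : seq nat) : bool :=
  is_partition b &&
  has (fun i => (0 < nth 0 a i) && (nth 0 a i == nth 0 a i.+1) &&
         (b == rm0 (set_nth 0 (set_nth 0 a i (nth 0 a i - 1)) i.+1 (nth 0 a i - 1))))
      (iota 0 (size a)).

Inductive dom_seq : seq nat -> seq nat -> nat -> Prop :=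
  | dom_nil a : dom_seq a a 0
  | dom_h a b c v : hdom a b -> dom_seq b c v -> dom_seq a c v
  | dom_v a b c v : vdom a b -> dom_seq b c v -> dom_seq a c v.+1.

(* Main.v *)
Require Import Defs.
From mathcomp Require Import all_boot all_order all_algebra all_fingroup.
From mathcomp Require Import zify ring.
Import Order.TTheory GRing.Theory Num.Theory.
Set Implicit Arguments. Unset Strict Implicit. Unset Printing Implicit Defensive.

(** Let [n] be the degree vector of [lam], with even entries [2a] and odd entries
    [2b+1], and let [e], [o] be their numbers. Row-reducing separately the even and
    the odd Hermite polynomials of the Wronskian on their lowest coefficients
    replaces them by series starting with the monomials of exponents
    [0, 2, ..., 2e-2] and [1, 3, ..., 2o-1], the degree vector of the 2-core
    (possibly with zero parts added). Hence the Wronskian starts in degree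
    [|core|]. As the coefficient of [x^(2i+d)] in [He_(2m+d)] is a function of [m]
    times a function of [i] times the falling factorial [m^_i], its leading
    coefficient is a product of two Vandermonde determinants, and after division by
    [Delta n] what remains is a ratio [G n / G core], where [G n] is the product of
    the signed odd factorials of the entries of [n] divided by the product of the
    differences between odd and even entries. In each row of [lam] the hook lengths
    together with the differences [n_i - n_j], [j > i], are [1, ..., n_i];
    keeping the odd ones gives [G n = +- H_odd lam]. The sign is read off
    row by row, and matches the one of the domino removals because the parity of
    the number of vertical dominoes is determined by the numbers of boxes and of
    boxes in even columns (counted from 0). *)

(** * Degree vectors and the parity of domino removals *)

Lemma degvec_cons x l : degvec (x :: l) = (x + size l) :: degvec l.
Proof.
rewrite /degvec /=; congr (_ :: _); first by rewrite subn1 addnS.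
rewrite -[1]addn0 iotaDl -map_comp; apply: eq_map => i /=.
by rewrite addnS subSS.
Qed.

Lemma size_degvec l : size (degvec l) = size l.
Proof. by rewrite size_map size_iota. Qed.

Lemma sum_set_nth (f : nat -> nat) l i y : i < size l ->
  \sum_(x <- set_nth 0 l i y) f x + f (nth 0 l i) = \sum_(x <- l) f x + f y.
Proof.
elim: l i => [|a l IH] [|i] //= ilt; rewrite !big_cons.
  rewrite [LHS]addnC [X in _ + X = _]addnC addnA. done.
by rewrite -!addnA IH.
Qed.

Lemma sum_rm0 (f : nat -> nat) l : f 0 = 0 ->
  \sum_(x <- rm0 l) f x = \sum_(x <- l) f x.
Proof.
by move=> f0; rewrite big_filter big_mkcond /=; apply: eq_bigr => -[|x] _.
Qed.

(** The number of boxes in even columns, counted from 0. *)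
Definition uphalves l := \sum_(x <- l) uphalf x.

(** A horizontal domino meets one even and one odd column. *)
Lemma hdom_invariant a b : hdom a b ->
  sumn a = sumn b + 2 /\ uphalves a = uphalves b + 1.
Proof.
case/andP=> _ /hasP[i]; rewrite mem_iota => /andP[_ ilt] /andP[age2 /eqP->].
rewrite /uphalves (sum_rm0 _ (f := uphalf)) // !sumnE (sum_rm0 _ (f := id)) //.
have := sum_set_nth id (nth 0 a i - 2) ilt.
have := sum_set_nth uphalf (nth 0 a i - 2) ilt.
move: (nth 0 a i) age2 => -[|[|x]] //= _; rewrite subn2 /=.
set s1 := \sum_(_ <- _) _; set s2 := \sum_(_ <- _) _.
set s3 := \sum_(_ <- _) _; set s4 := \sum_(_ <- _) _.
move: s1 s2 s3 s4 => s1 s2 s3 s4; lia.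
Qed.

(** Both boxes of a vertical domino lie in the same column, so [uphalves] drops by 0 or 2. *)
Lemma vdom_invariant a b : vdom a b ->
  sumn a = sumn b + 2 /\ odd (uphalves a) = odd (uphalves b).
Proof.
case/andP=> _ /hasP[i]; rewrite mem_iota => /andP[_ ilt].
case/andP=> /andP[agt0 /eqP aE] /eqP->.
have i1lt : i.+1 < size a.
  by rewrite ltnNge; apply/negP => /(nth_default 0) a0; rewrite aE a0 in agt0.
rewrite /uphalves (sum_rm0 _ (f := uphalf)) // !sumnE (sum_rm0 _ (f := id)) //.
set y := nth 0 a i - 1.
have i1lt' : i.+1 < size (set_nth 0 a i y) by rewrite size_set_nth leq_max i1lt orbT.
have nE : nth 0 (set_nth 0 a i y) i.+1 = nth 0 a i.
  by rewrite nth_set_nth /= -aE gtn_eqF.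
have := sum_set_nth id y ilt; have := sum_set_nth id y i1lt'.
have := sum_set_nth uphalf y ilt; have := sum_set_nth uphalf y i1lt'.
rewrite nE /y; move: (nth 0 a i) agt0 => -[|x] //= _; rewrite subn1 /=.
set s1 := \sum_(_ <- _) _; set s2 := \sum_(_ <- _) _.
set s3 := \sum_(_ <- _) _; set s4 := \sum_(_ <- _) _.
set s5 := \sum_(_ <- _) _; set s6 := \sum_(_ <- _) _.
move: s1 s2 s3 s4 s5 s6 => s1 s2 s3 s4 s5 s6.
rewrite uphalfE; lia.
Qed.

(* Unlike the usual invariants of domino removals, the number of boxes in even
   columns is a symmetric function of the parts. Hence it also controls the steps
   [a -> b] in which [hdom] empties a row above the last one. *)
Lemma dom_seq_sign a b v : dom_seq a b v ->
  odd (v + (sumn a - sumn b)./2) = odd (uphalves a + uphalves b).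
Proof.
move=> ab; have [//] : odd (v + (sumn a - sumn b)./2) = odd (uphalves a + uphalves b)
  /\ exists d, sumn a = sumn b + d.*2.
elim: ab => {a b v} [a|a b c v /hdom_invariant[sE uE] _ [IH [d dE]]
  |a b c v /vdom_invariant[sE uE] _ [IH [d dE]]]; last 2 first.
- move: IH; rewrite sE uE dE !addKn -addnA addKn => IH.
  split; last by exists d.+1; rewrite doubleS addn2.
  by rewrite doubleK addn2 -doubleS doubleK in IH *; lia.
- move: IH; rewrite sE dE !addKn -addnA addKn => IH.
  split; last by exists d.+1; rewrite doubleS addn2.
  by rewrite doubleK addn2 -doubleS doubleK in IH *; lia.
by split; [rewrite subnn addnn odd_double | exists 0; rewrite addn0].
Qed.

(** * Hook lengths row by row *)

(** Induction on the rows below. With [y] the next row, the first [y] hook lengths and the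
    differences to the rows after it are those of row [y] shifted by [x - y + 1]. The columns beyond
    [y] have no leg and give [1, ..., x - y]; the difference to the entry of [y] itself is
    [x - y + 1]. *)
Lemma hook_row_perm x l : sorted geq (x :: l) ->
  perm_eq ([seq x - j + count (fun y => j < y) l | j <- iota 0 x]
           ++ [seq x + size l - m | m <- degvec l])
          (iota 1 (x + size l)).
Proof.
elim: l x => [|y l IH] x.
  move=> _ /=; rewrite cats0 addn0.
  have -> : [seq x - j + 0 | j <- iota 0 x] = rev (iota 1 x).
    apply: (@eq_from_nth _ 0); first by rewrite size_map size_rev !size_iota.
    move=> i; rewrite size_map size_iota => ilt.
    by rewrite (nth_map 0) ?size_iota // nth_rev ?size_iota // !nth_iota; lia.
  by rewrite perm_rev.
rewrite degvec_cons /= => /andP[/= yx yl].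
have {IH} IH := IH y yl.
have ley z : z \in l -> z <= y.
  have := @order_path_min _ geq y l (rev_trans leq_trans) yl.
  by move/allP => /(_ z).
have -> : iota 0 x = iota 0 y ++ iota y (x - y).
  by rewrite -{2}[y]add0n -iotaD subnKC.
rewrite map_cat.
have -> : [seq x - j + ((j < y) + count (fun z => j < z) l) | j <- iota 0 y]
    = [seq (x - y).+1 + i | i <- [seq y - j + count (fun z => j < z) l | j <- iota 0 y]].
  rewrite -map_comp; apply/eq_in_map => j; rewrite mem_iota /= => jy.
  by rewrite jy; lia.
have -> : [seq x - j + ((j < y) + count (fun z => j < z) l) | j <- iota y (x - y)]
    = rev (iota 1 (x - y)).
  apply: (@eq_from_nth _ 0); first by rewrite size_map size_rev !size_iota.
  move=> i; rewrite size_map size_iota => ilt.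
  rewrite (nth_map 0) ?size_iota // nth_rev ?size_iota // !nth_iota; try lia.
  have /eqP -> : count (fun z => y + i < z) l == 0.
    rewrite -leqn0 leqNgt -has_count; apply/hasPn => z zl.
    by have := ley z zl; lia.
  lia.
have -> : [seq x + (size l).+1 - m | m <- degvec l]
    = [seq (x - y).+1 + i | i <- [seq y + size l - m | m <- degvec l]].
  rewrite -map_comp; apply/eq_in_map => m /(nthP 0)[i].
  rewrite size_degvec => il <- /=.
  rewrite /degvec (nth_map 0) ?size_iota // nth_iota // add0n.
  by have := ley _ (mem_nth 0 il); move: (nth 0 l i) => w wy; move: (size l) il => L il; lia.
have -> : x + (size l).+1 = (x - y) + (1 + (y + size l)) by lia.
rewrite iotaD iotaD add1n [iota _ 1]/=.
have -> : iota ((x - y).+1 + 1) (y + size l) = [seq (x - y).+1 + i | i <- iota 1 (y + size l)].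
  by rewrite -iotaDl.
have -> : x - y + (1 + (y + size l)) - (y + size l) = (x - y).+1 by lia.
set A := map _ _; set B := map _ (map _ (degvec l)); set C := map _ (iota _ _).
have : perm_eq (A ++ B) C by rewrite -map_cat; apply: perm_map.
set D := iota 1 (x - y); set u := (x - y).+1 => ABC.
have rD : perm_eq (rev D) D by rewrite perm_rev.
apply/seq.permP => p; move/seq.permP: ABC => /(_ p); move/seq.permP: rD => /(_ p).
rewrite !count_cat /= => -> <-; rewrite add1n -/u.
move: (count p A) (count p B) (count p D) (p u : nat); lia.
Qed.

Lemma degvec_lt x l m : sorted geq (x :: l) -> m \in degvec l -> (m < x + size l).
Proof.
move=> xl /(nthP 0)[i]; rewrite size_degvec => il <-.
rewrite /degvec (nth_map 0) ?size_iota // nth_iota // add0n.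
have := @order_path_min _ geq x l (rev_trans leq_trans) xl.
move/allP => /(_ _ (mem_nth 0 il)) /=.
by move: (nth 0 l i) => w wy; move: (size l) il => L il; lia.
Qed.

(** Hooks look only right and down: a top row that is long enough adds 1 both to the column count
    and to the row index of a lower box. *)
Lemma Hodd_cons x l : sorted geq (x :: l) ->
  Hodd (x :: l) =
  (\prod_(h <- [seq x - j + count (fun y => j < y) l | j <- iota 0 x] | odd h) h) * Hodd l.
Proof.
move=> xl; rewrite /Hodd /= big_ord_recl /=.
have lex y : y \in l -> y <= x.
  have := @order_path_min _ geq x l (rev_trans leq_trans) xl.
  by move/allP => /(_ y).
congr (_ * _).
  have -> : iota 0 x = index_iota 0 x by rewrite /index_iota subn0.
  rewrite big_map big_mkord.
  have hE (j : 'I_x) : hook (x :: l) 0 j = x - j + count (fun y => j < y) l.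
    by rewrite /hook /= ltn_ord; have := ltn_ord j; lia.
  by apply: eq_big => j; rewrite hE.
apply: eq_bigr => i _.
have hE (j : 'I_(nth 0 l i)) : hook (x :: l) (lift ord0 i) j = hook l i j.
  rewrite /hook /= (leq_trans (ltn_ord j)) ?lex ?mem_nth //.
by apply: eq_big => j; rewrite hE.
Qed.


(** * Staircases and padding by zero parts *)

Lemma staircaseS k : staircase k.+1 = k.+1 :: staircase k.
Proof.
rewrite /staircase /=; congr (_ :: _).
by rewrite -[1]addn0 iotaDl -map_comp; apply: eq_map => i /=; rewrite subSS.
Qed.

Lemma size_staircase k : size (staircase k) = k.
Proof. by rewrite size_map size_iota. Qed.

Lemma count_staircase k j : count (fun y => j < y) (staircase k) = k - j.
Proof.
elim: k => [|k IH]; first by rewrite sub0n.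
by rewrite staircaseS /= IH; case: leqP => h; lia.
Qed.

Lemma sumn_staircase k : (sumn (staircase k)).*2 = k * k.+1.
Proof. elim: k => [|k IH] //; rewrite staircaseS /=; lia. Qed.

(** In a staircase the arm and the leg of every box are equal, so all hook lengths are odd. *)
Lemma Hprod_staircase k : Hprod (staircase k) = Hodd (staircase k).
Proof.
apply: eq_bigr => i _; apply: eq_bigl => j; rewrite /hook count_staircase.
case: i j => i /= ilt [j /= jlt]; rewrite size_staircase in ilt.
by move: jlt; rewrite (nth_map 0) ?size_iota // nth_iota // add0n; lia.
Qed.

(** Zero parts add no box. They serve to give the core a degree vector of the same length as that of
    [lam]. *)
Lemma Hodd_pad l z : Hodd (l ++ nseq z 0) = Hodd l.
Proof.
have nthE i : nth 0 (l ++ nseq z 0) i = nth 0 l i.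
  rewrite nth_cat nth_nseq if_same; case: ltnP => // li; by rewrite nth_default.
have hE i j : hook (l ++ nseq z 0) i j = hook l i j.
  by rewrite /hook nthE count_cat [count _ (nseq _ _)]count_nseq mul0n addn0.
rewrite /Hodd size_cat big_split_ord /= [X in _ * X]big1 ?muln1 => [|i _]; last first.
  by rewrite nthE nth_default ?leq_addr // big_ord0.
apply: eq_bigr => i _; rewrite nthE.
by apply: eq_big => j; rewrite hE.
Qed.

Lemma sorted_staircase_pad k z : sorted geq (staircase k ++ nseq z 0).
Proof.
elim: k => [|k IH]; first by case: z => //= z; elim: z => //=.
rewrite staircaseS /= path_min_sorted //; apply/allP => x.
rewrite mem_cat mem_nseq => /orP[/mapP[i _ ->]|/andP[_ /eqP->]] //=.
by rewrite (leq_trans (leq_subr _ _)).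
Qed.

Lemma uphalves_pad l z : uphalves (l ++ nseq z 0) = uphalves l.
Proof.
rewrite /uphalves big_cat /= [X in _ + X]big1_seq ?addn0 // => i /andP[_].
by rewrite mem_nseq => /andP[_ /eqP->].
Qed.

(** The inverse, up to order, of splitting a set of integers into its two runners modulo 2, as in
    the construction of the 2-quotient. *)
Definition merge_parities (a b : seq nat) : seq nat :=
  [seq x.*2 | x <- a] ++ [seq x.*2.+1 | x <- b].

Lemma perm_merge_iotaS_even e o :
  perm_eq (e.*2 :: merge_parities (iota 0 e) (iota 0 o))
    (merge_parities (iota 0 e.+1) (iota 0 o)).
Proof.
rewrite /merge_parities -[e.+1]addn1 iotaD map_cat /= -catA perm_sym.
by rewrite perm_catC /= perm_cons perm_catC.
Qed.

Lemma perm_merge_iotaS_odd e o :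
  perm_eq (o.*2.+1 :: merge_parities (iota 0 e) (iota 0 o))
    (merge_parities (iota 0 e) (iota 0 o.+1)).
Proof.
by rewrite /merge_parities -[o.+1]addn1 iotaD map_cat /= catA cats1 perm_sym perm_rcons.
Qed.

Lemma perm_degvec_nseq0 z :
  perm_eq (degvec (nseq z 0)) (merge_parities (iota 0 (uphalf z)) (iota 0 z./2)).
Proof.
elim: z => // z IH.
rewrite -[nseq _ _]/(0 :: nseq z 0) degvec_cons size_nseq add0n /=.
rewrite -(perm_cons z) in IH; apply: (perm_trans IH); rewrite uphalf_half -{1}(odd_double_half z).
by case: (odd z); rewrite ?perm_merge_iotaS_even ?perm_merge_iotaS_odd.
Qed.

(** The zeros give [0, ..., 2e - 1]; each row of the staircase then adds the next odd number. *)
Lemma perm_degvec_staircase_even k e :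
  perm_eq (degvec (staircase k ++ nseq e.*2 0))
          (merge_parities (iota 0 e) (iota 0 (e + k))).
Proof.
elim: k => [|k IH].
  by apply: (perm_trans (perm_degvec_nseq0 _)); rewrite uphalf_double doubleK addn0.
rewrite staircaseS cat_cons degvec_cons size_cat size_staircase size_nseq addnS.
have -> : k.+1 + (k + e.*2) = (e + k).*2.+1 by lia.
by rewrite -(perm_cons (e + k).*2.+1) in IH; rewrite (perm_trans IH) ?perm_merge_iotaS_odd.
Qed.

(** The zeros give [0, ..., 2o], one more even than odd; each row then adds the next even number. *)
Lemma perm_degvec_staircase_odd k o :
  perm_eq (degvec (staircase k ++ nseq o.*2.+1 0))
          (merge_parities (iota 0 (o + k).+1) (iota 0 o)).
Proof.
elim: k => [|k IH].
  by apply: (perm_trans (perm_degvec_nseq0 _)); rewrite /= doubleK uphalf_double addn0.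
rewrite staircaseS cat_cons degvec_cons size_cat size_staircase size_nseq (addnS o).
have -> : k.+1 + (k + o.*2.+1) = (o + k).+1.*2 by lia.
by rewrite -(perm_cons (o + k).+1.*2) in IH; rewrite (perm_trans IH) ?perm_merge_iotaS_even.
Qed.

Lemma size_merge_parities a b : size (merge_parities a b) = (size a + size b).
Proof. by rewrite size_cat !size_map. Qed.

(** * Maya diagrams *)

Lemma sum_ord_tri n : (\sum_(i < n) i) * 2 + n = n * n.
Proof.
elim: n => [|n]; first by rewrite big_ord0.
by rewrite big_ord_recr /=; move: (\sum_(_ < n) _) => S; lia.
Qed.

Lemma sumn_degvec l : sumn (degvec l) = sumn l + \sum_(i < size l) i.
Proof.
elim: l => [|x l IH]; first by rewrite big_ord0.
rewrite degvec_cons big_ord_recr /= IH; move: (\sum_(_ < _) _) => S; rewrite -/(size l); lia.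
Qed.

Lemma degvec_uniq l : sorted geq l -> uniq (degvec l).
Proof.
elim: l => // x l IH xl; rewrite degvec_cons /= (IH (path_sorted xl)) andbT.
by apply/negP => /(degvec_lt xl); rewrite ltnn.
Qed.

Lemma degvec_pad l z :
  degvec (l ++ nseq z 0) = [seq x + z | x <- degvec l] ++ degvec (nseq z 0).
Proof.
elim: l => // x l IH.
by rewrite cat_cons !degvec_cons IH size_cat size_nseq addnA.
Qed.

Lemma sorted_geq_rm0 l : sorted geq l -> l = rm0 l ++ nseq (count (pred1 0) l) 0.
Proof.
elim: l => // x l IH xl; rewrite {1}(IH (path_sorted xl)) /=.
case: x xl => [|x] xl //=.
have l0 : all (pred1 0) l.
  have := @order_path_min _ geq 0 l (rev_trans leq_trans) xl.
  by apply: sub_all => -[].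
have -> : rm0 l = [::].
  by apply/eqP; rewrite -[_ == _]negbK -has_filter -all_predC; apply: sub_all l0 => -[].
by [].
Qed.

Lemma path_gtn_min m G : path gtn m G -> all (gtn m) G.
Proof. by apply: order_path_min => x y z /= yx zy; apply: ltn_trans zy yx. Qed.

Lemma sorted_gtn_uniq G : sorted gtn G -> uniq G.
Proof.
apply: sorted_uniq => [y x z /= yx zy|x /=]; last by rewrite ltnn.
exact: ltn_trans zy yx.
Qed.

Definition gaps (F : seq nat) (m : nat) := count (fun n => n \notin F) (iota 0 m).

Lemma gaps_top m G : path gtn m G -> gaps (m :: G) m = m - size G.
Proof.
move=> mG; have ltm := path_gtn_min mG; have Gu := sorted_gtn_uniq (path_sorted mG).
have -> : gaps (m :: G) m = count (predC (mem G)) (iota 0 m).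
  rewrite /gaps; apply: eq_in_count => n; rewrite mem_iota /= add0n => nm.
  by rewrite !inE ltn_eqF.
have := count_predC (mem G) (iota 0 m); rewrite size_iota.
have -> : count (mem G) (iota 0 m) = size G.
  rewrite -size_filter; apply: perm_size; apply: uniq_perm => //.
    by rewrite filter_uniq // iota_uniq.
  move=> x; rewrite mem_filter /= mem_iota /= add0n; case xG: (x \in G) => //=.
  by move/allP: ltm => /(_ _ xG).
by move: (count _ _) => c <-; rewrite addKn.
Qed.

Lemma gaps_cons m G x : x \in G -> path gtn m G -> gaps (m :: G) x = gaps G x.
Proof.
move=> xG mG; apply: eq_in_count => n; rewrite mem_iota /= add0n => nx.
have /allP/(_ _ xG) /= xm := path_gtn_min mG.
by rewrite inE ltn_eqF // (ltn_trans nx xm).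
Qed.

(** Counting gaps inverts [degvec]: the largest entry [m] has [size G] entries below it, hence
    [m - size G] gaps, and [degvec] adds [size G] back. *)
Lemma degvec_gaps G : sorted gtn G ->
  degvec [seq gaps G m | m <- G] = G /\ sorted geq [seq gaps G m | m <- G].
Proof.
elim: G => // m G IH mG; have [IH1 IH2] := IH (path_sorted mG).
have GE : [seq gaps (m :: G) x | x <- G] = [seq gaps G x | x <- G].
  by apply/eq_in_map => x xG; apply: gaps_cons.
have sz : size G <= m.
  have ltm := path_gtn_min mG; have Gu := sorted_gtn_uniq (path_sorted mG).
  rewrite -(size_iota 0 m); apply: uniq_leq_size => // x xG.
  by rewrite mem_iota; move/allP: ltm => /(_ _ xG).
rewrite map_cons GE gaps_top // degvec_cons IH1 size_map subnK //; split=> //.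
rewrite /= path_min_sorted //; apply/allP => _ /mapP[x xG ->] /=.
have /allP/(_ _ xG) /= xm := path_gtn_min mG.
rewrite -(gaps_top mG) -(gaps_cons xG mG) /gaps -(subnKC (ltnW xm)) iotaD count_cat.
exact: leq_addr.
Qed.

Lemma geq_total : total geq. Proof. by move=> x y; apply: leq_total. Qed.
Lemma geq_trans : transitive geq.
Proof. by move=> y x z /= yx zy; apply: leq_trans zy yx. Qed.
Lemma geq_anti : antisymmetric geq.
Proof. by move=> x y; rewrite andbC; apply: anti_leq. Qed.

(** [z] counts the zero parts that [maya_part] discards; restoring them makes the degree vector a
    reordering of [F]. *)
Lemma maya_part_padded F : uniq F ->
  exists z, sorted geq (maya_part F) /\ perm_eq F (degvec (maya_part F ++ nseq z 0)).
Proof.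
move=> uF; set G := sort geq F.
have FG : perm_eq G F by rewrite perm_sort.
have sG : sorted gtn G.
  by rewrite gtn_sorted_uniq_geq sort_uniq uF sort_sorted //; apply: geq_total.
have [dG sgG] := degvec_gaps sG.
have mE : maya_part F = rm0 [seq gaps G m | m <- G].
  rewrite /maya_part -/(rm0 _).
  have -> : [seq count (fun n => n \notin F) (iota 0 m) | m <- F] = [seq gaps G m | m <- F].
    by apply: eq_map => m; apply: eq_count => n; rewrite (perm_mem FG).
  rewrite -[RHS](sorted_sort geq_trans); last exact: sorted_filter geq_trans _ _ _.
  apply/perm_sortP; [exact: geq_total|exact: geq_trans|exact: geq_anti|].
  by apply: perm_filter; apply: perm_map; rewrite perm_sym.
exists (count (pred1 0) [seq gaps G m | m <- G]); rewrite mE; split.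
  exact: sorted_filter geq_trans _ _ _.
by rewrite -sorted_geq_rm0 // dG perm_sym.
Qed.

Lemma count_odd_merge a b : count odd (merge_parities a b) = size b.
Proof.
rewrite count_cat !count_map (eq_count (a2 := pred0)) => [|x /=]; last by rewrite odd_double.
rewrite count_pred0 (eq_count (a2 := predT)) => [|x /=]; last by rewrite odd_double.
by rewrite count_predT.
Qed.

Lemma count_even_merge a b : count (fun m => ~~ odd m) (merge_parities a b) = size a.
Proof.
rewrite count_cat !count_map addnC (eq_count (a2 := pred0)) => [|x /=]; last by rewrite odd_double.
rewrite count_pred0 (eq_count (a2 := predT)) => [|x /=]; last by rewrite odd_double.
by rewrite count_predT.
Qed.

Lemma sumn_merge a b : sumn (merge_parities a b) = (sumn a + sumn b).*2 + size b.
Proof.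
rewrite sumn_cat; have -> : sumn [seq x.*2 | x <- a] = (sumn a).*2.
  by elim: a => //= x a ->; rewrite doubleD.
have -> : sumn [seq x.*2.+1 | x <- b] = (sumn b).*2 + size b.
  by elim: b => //= x b ->; lia.
by rewrite doubleD addnA.
Qed.

Lemma perm_merge a a' b b' : perm_eq a a' -> perm_eq b b' ->
  perm_eq (merge_parities a b) (merge_parities a' b').
Proof. by move=> aa bb; apply: perm_cat; apply: perm_map. Qed.

Lemma is_partition_sorted_pad l z : is_partition l -> sorted geq (l ++ nseq z 0).
Proof.
case/andP=> sl _; elim: l sl => [_|x l IH xl]; first by elim: z => // -[|z].
rewrite cat_cons /= path_min_sorted ?IH ?(path_sorted xl) //; apply/allP => y.
have /allP lex := order_path_min geq_trans xl.
by rewrite mem_cat mem_nseq => /orP[/lex //|/andP[_ /eqP->]].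
Qed.

Lemma degvec_nseq_iota z : perm_eq (degvec (nseq z 0)) (iota 0 z).
Proof.
elim: z => // z IH; rewrite -[nseq _ _]/(0 :: nseq z 0) degvec_cons size_nseq add0n.
by rewrite -[z.+1]addn1 iotaD cats1 perm_sym perm_rcons perm_cons perm_sym.
Qed.

(** [F] is the merge of [a] and [b], with [k] more odd than even entries, and also the degree vector
    of [lam] padded by [z] zeros. Undoing the padding removes [0, ..., z - 1] and lowers the rest by
    [z]. For even [z] the surplus stays [k]; for odd [z] it grows to [k + 1] and the parities are
    exchanged. *)
Lemma Phi_degvec mu nu k : is_partition mu -> is_partition nu ->
  let lam := Phi mu nu k in
  let e := count (fun m => ~~ odd m) (degvec lam) in
  let o := count odd (degvec lam) in
  [/\ sorted geq lam, (o = e + k) \/ (e = (o + k).+1) &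
      sumn lam = sumn (staircase k) + (sumn mu + sumn nu).*2].
Proof.
move=> pmu pnu; rewrite /Phi; set F := _ ++ _; set lam := maya_part F.
set o := count odd (degvec lam); set e := count _ (degvec lam).
pose a := degvec (mu ++ nseq (size nu) 0).
pose b := degvec (nu ++ nseq (k + size mu) 0).
have ua : uniq a by apply/degvec_uniq/is_partition_sorted_pad.
have ub : uniq b by apply/degvec_uniq/is_partition_sorted_pad.
have pad_perm l z : perm_eq (iota 0 z ++ [seq x + z | x <- degvec l]) (degvec (l ++ nseq z 0)).
  by rewrite degvec_pad perm_catC perm_cat2l perm_sym degvec_nseq_iota.
have Fab : perm_eq F (merge_parities a b).
  have -> : F = merge_parities (iota 0 (size nu) ++ [seq x + size nu | x <- degvec mu])
      (iota 0 (k + size mu) ++ [seq x + (k + size mu) | x <- degvec nu]).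
    rewrite /F /merge_parities !map_cat -!map_comp -catA.
    by congr (_ ++ (_ ++ (_ ++ _))); apply: eq_map => x /=; rewrite mul2n.
  exact: perm_merge.
have uF : uniq F.
  have inj1 : injective (fun x => x.*2.+1) by move=> x y [] /double_inj.
  rewrite (perm_uniq Fab) cat_uniq (map_inj_uniq double_inj) (map_inj_uniq inj1) ua ub andbT.
  by apply/hasPn => _ /mapP[x _ ->]; apply/mapP => -[y _]; lia.
have [z [slam Flam]] := maya_part_padded uF.
rewrite -/lam in slam Flam.
have counts := fun p => etrans (esym (seq.permP Fab p)) (seq.permP Flam p).
have sza : size a = size mu + size nu by rewrite size_degvec size_cat size_nseq.
have szb : size b = k + size mu + size nu by rewrite size_degvec size_cat size_nseq addnC.
have zE : perm_eq (degvec (nseq z 0)) (merge_parities (iota 0 (uphalf z)) (iota 0 z./2)).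
  exact: perm_degvec_nseq0.
have ce : count odd (degvec (lam ++ nseq z 0)) = (if odd z then e else o) + z./2.
  rewrite degvec_pad count_cat (seq.permP zE) count_odd_merge size_iota count_map; congr (_ + _).
  by case: (boolP (odd z)) => zo; apply: eq_count => x /=; rewrite oddD ?zo ?(negPf zo) ?addbT ?addbF.
have co : count (fun m => ~~ odd m) (degvec (lam ++ nseq z 0)) =
    (if odd z then o else e) + uphalf z.
  rewrite degvec_pad count_cat (seq.permP zE) count_even_merge size_iota count_map; congr (_ + _).
  by case: (boolP (odd z)) => zo; apply: eq_count => x /=; rewrite oddD ?zo ?(negPf zo) ?addbT ?addbF ?negbK.
rewrite -counts count_odd_merge szb in ce.
rewrite -counts count_even_merge sza in co.
split=> //.
  by move: ce co; rewrite uphalf_half; case: (odd z) => /=; rewrite ?add1n ?add0n; [right|left]; lia.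
(* The sum of a degree vector is the number of boxes plus a triangular number, so equating the sums
   in [Fab] and [Flam] gives the size of [lam]. *)
have := perm_sumn Fab; rewrite (perm_sumn Flam) sumn_merge szb /a /b.
rewrite !sumn_degvec !sumn_cat !sumn_nseq !mul0n !addn0.
have -> : size (lam ++ nseq z 0) = size F by rewrite (perm_size Flam) size_degvec.
have -> : size F = size a + size b by rewrite (perm_size Fab) size_merge_parities.
rewrite -!(size_degvec (_ ++ _)) -/a -/b sza szb.
have := sumn_staircase k.
have := sum_ord_tri (size mu + size nu).
have := sum_ord_tri (k + size mu + size nu).
have := sum_ord_tri (size mu + size nu + (k + size mu + size nu)).
move: (\sum_(_ < _) _) => S1; move: (\sum_(_ < _) _) => S2; move: (\sum_(_ < _) _) => S3.
rewrite -[k + _ + _]addnA; move: (size mu + size nu) => E.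
move: (sumn lam) (sumn mu) (sumn nu) (sumn (staircase k)) => L m n K; lia.
Qed.

Local Open Scope ring_scope.

(** * Odd hook lengths *)

(** The lowest non-zero coefficient of [He n], that of [x^(odd n)]: an odd double factorial up to
    sign. *)
Definition alpha (n : nat) : rat :=
  (-1) ^+ n./2 * \prod_(t <- iota 1 n | odd t) t%:R.

(** Each difference is odd minus even, so the product does not depend on the order of [s]. *)
Definition cross (s : seq nat) : rat :=
  \prod_(x <- s | ~~ odd x) \prod_(y <- s | odd y) (y%:R - x%:R).

Lemma cross_cons x s : cross (x :: s) = cross s *
  (if odd x then \prod_(y <- s | ~~ odd y) (x%:R - y%:R)
            else \prod_(y <- s | odd y) (y%:R - x%:R)).
Proof.
rewrite /cross big_cons; case: (boolP (odd x)) => xo /=.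
  rewrite -big_split /=; apply: eq_bigr => y _.
  by rewrite big_cons xo mulrC.
rewrite big_cons (negPf xo) mulrC; congr (_ * _).
by apply: eq_bigr => y _; rewrite big_cons (negPf xo).
Qed.

Lemma alpha_neq0 n : alpha n != 0.
Proof.
rewrite mulf_neq0 ?signr_eq0 // prodf_seq_neq0; apply/allP => i _.
by case: i => //= i; rewrite pnatr_eq0 implybT.
Qed.

Definition sum_half (n : nat) : nat := \sum_(i < n) i./2.

(** The part of the sign in [Hodd_cross] that depends only on the numbers of even and odd entries.
    It is common to [lam] and its padded core and cancels in the quotient. *)
Definition sign_exp (e o : nat) : nat := sum_half (e + o) + e * o + uphalf o.

Lemma sign_exp_even x e o : ~~ odd (x + (e + o)) ->
  odd (sign_exp e.+1 o + uphalf x) = odd (sign_exp e o + (x + (e + o))./2 + o).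
Proof.
rewrite /sign_exp /sum_half addSn big_ord_recr /= mulSn.
move: (\sum_(i < _) _)%N (e * o)%N => A B; rewrite uphalfE; lia.
Qed.

Lemma sign_exp_odd x e o : odd (x + (e + o)) ->
  odd (sign_exp e o.+1 + uphalf x) = odd (sign_exp e o + (x + (e + o))./2).
Proof.
rewrite /sign_exp /sum_half addnS big_ord_recr /= mulnS.
move: (\sum_(i < _) _)%N (e * o)%N => A B; rewrite !uphalfE; lia.
Qed.

Lemma Hodd_cross_cons x l : sorted geq (x :: l) ->
  (Hodd (x :: l))%:R * \prod_(m <- degvec l | odd (x + size l - m)) ((x + size l)%:R - m%:R)
  = (Hodd l)%:R * \prod_(t <- iota 1 (x + size l) | odd t) t%:R :> rat.
Proof.
move=> xl; rewrite -(perm_big _ (hook_row_perm xl)) /= big_cat /= Hodd_cons //.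
rewrite natrM mulrAC [LHS]mulrC; congr (_ * _); rewrite natr_prod; congr (_ * _).
rewrite [RHS]big_map big_seq_cond [RHS]big_seq_cond; apply: eq_bigr => m /andP[ml _].
by rewrite natrB // ltnW // degvec_lt.
Qed.

(** Induction on the rows. A difference is odd exactly between entries of opposite parity, so
    [Hodd_cross_cons] supplies the new factors of [cross] up to sign. *)
Lemma Hodd_cross l : sorted geq l ->
  (-1) ^+ (sign_exp (count (fun m => ~~ odd m) (degvec l)) (count odd (degvec l))
           + uphalves l)
    * (Hodd l)%:R * cross (degvec l) = \prod_(m <- degvec l) alpha m.
Proof.
elim: l => [|x l IH] xl.
  by rewrite /Hodd /cross /= !big_nil /sign_exp /sum_half /uphalves !big_ord0 big_nil !mulr1.
have {IH} := IH (path_sorted xl).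
have H := Hodd_cross_cons xl.
rewrite !degvec_cons cross_cons big_cons /= /uphalves big_cons.
rewrite -/(uphalves l).
set e := count _ _; set o := count odd _.
have eo : (e + o = size l)%N.
  by rewrite -(size_degvec l) -(count_predC odd) addnC.
move=> IH; rewrite -IH; move: H; rewrite -eo {IH}.
set n := (x + (e + o))%N => H.
have -> : alpha n = (-1) ^+ n./2 * \prod_(t <- iota 1 n | odd t) t%:R by [].
have ltn m : m \in degvec l -> (m <= n)%N.
  by move=> ml; rewrite /n eo ltnW // degvec_lt.
case: ifPn => no; rewrite ?add0n ?add1n.
  rewrite addnA -signr_odd oddD sign_exp_odd // -oddD signr_odd !exprD.
  have -> : \prod_(y <- degvec l | ~~ odd y) (n%:R - y%:R) =
     \prod_(m <- degvec l | odd (n - m)) (n%:R - m%:R) :> rat.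
    rewrite big_seq_cond [RHS]big_seq_cond; apply: eq_bigl => m.
    by case ml: (m \in _) => //=; rewrite oddB ?no // ltn.
  ring: H.
rewrite addnA -signr_odd oddD sign_exp_even // -oddD signr_odd !exprD.
(* [cross] subtracts the even [n] from each odd [y]; reversing these [o] differences costs
   [(-1) ^+ o]. *)
have -> : \prod_(y <- degvec l | odd y) (y%:R - n%:R) =
   (-1) ^+ o * \prod_(m <- degvec l | odd (n - m)) (n%:R - m%:R) :> rat.
  have -> : \prod_(m <- degvec l | odd (n - m)) (n%:R - m%:R) =
     \prod_(m <- degvec l | odd m) (n%:R - m%:R) :> rat.
    rewrite big_seq_cond [RHS]big_seq_cond; apply: eq_bigl => m.
    by case ml: (m \in _) => //=; rewrite oddB ?(negPf no) // ltn.
  rewrite /o; elim: (degvec l) => [|y s IHs]; first by rewrite !big_nil mulr1.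
  by rewrite !big_cons /=; case: ifP => // _; rewrite IHs exprS; ring.
have oo : (-1) ^+ o * (-1) ^+ o = 1 :> rat by rewrite -expr2 sqrr_sign.
move: H oo; rewrite -/n; move: ((-1) ^+ o) ((-1) ^+ n./2) => s u H oo; ring: H oo.
Qed.

(** * Hermite polynomials *)

Lemma prod_odd_recr n : \prod_(t <- iota 1 n.+1 | odd t) t%:R =
  (\prod_(t <- iota 1 n | odd t) t%:R) * (if odd n then 1 else n.+1%:R) :> rat.
Proof.
rewrite -[n.+1]addn1 iotaD big_cat big_cons big_nil add1n addn1 /=.
by case: (odd n); rewrite ?mulr1.
Qed.

Lemma alpha_odd m : alpha m.*2.+1 = m.*2.+1%:R * alpha m.*2.
Proof.
by rewrite /alpha prod_odd_recr /= odd_double uphalf_double doubleK mulrA mulrC.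
Qed.

Lemma alpha_even m : alpha m.*2.+2 = - alpha m.*2.+1.
Proof.
rewrite /alpha [in LHS]prod_odd_recr /= odd_double uphalf_double doubleK mulr1.
by rewrite exprS mulN1r mulNr.
Qed.

(** For [d] equal to 0 or 1, the factor depending on [i] in the coefficient of [x^(2i + d)] in
    [He (2m + d)]. *)
Definition beta (d i : nat) : rat := (-2) ^+ i / (i.*2 + d)`!%:R.

Lemma beta0S i : i.+1%:R * beta 0 i.+1 = - beta 1 i.
Proof.
rewrite /beta addn0 addn1 doubleS factS natrM exprS.
have h : (i.*2.+1)`!%:R != 0 :> rat by rewrite pnatr_eq0 -lt0n fact_gt0.
have h' : i.+1%:R != 0 :> rat by rewrite pnatr_eq0.
rewrite -doubleS -mul2n natrM.
move: (i.*2.+1)`!%:R i.+1%:R ((-2) ^+ i) h h' => f n t h h'; field.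
by rewrite h h'.
Qed.

Lemma beta1E i : (i.*2.+1)%:R * beta 1 i = beta 0 i.
Proof.
rewrite /beta addn0 addn1 factS natrM.
have h : (i.*2)`!%:R != 0 :> rat by rewrite pnatr_eq0 -lt0n fact_gt0.
have h' : (i.*2.+1)%:R != 0 :> rat by rewrite pnatr_eq0.
by move: (i.*2)`!%:R (i.*2.+1)%:R h h' => f n h h'; field; rewrite h h'.
Qed.

(* [He n] is ['X^(odd n)] times [halfHe (odd n) n./2] evaluated at ['X^2]. *)
Definition halfHe (d m : nat) : {poly rat} :=
  \poly_(i < m.+1) (alpha (m.*2 + d) * beta d i * (m ^_ i)%:R).

Lemma coef_halfHe d m i :
  (halfHe d m)`_i = alpha (m.*2 + d) * beta d i * (m ^_ i)%:R.
Proof.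
by rewrite coef_poly; case: ltnP => // mi; rewrite ffact_small // mulr0.
Qed.

Lemma ffactS_rec m i : (m.+1 ^_ i.+1 = i.+1 * m ^_ i + m ^_ i.+1)%N.
Proof.
have [im|mi] := leqP i m; last by rewrite !ffact_small //; lia.
by rewrite ffactSS ffactnSr -[(_ ^_ i * _)%N]mulnC -mulnDl; congr muln; lia.
Qed.

(** The three-term recurrence at even degree, in [y = x^2]: [x] times an odd polynomial [x q(y)] is
    [y q(y)], whence the factor ['X]. *)
Lemma halfHe0S m : halfHe 0 m.+1 = 'X * halfHe 1 m - m.*2.+1%:R *: halfHe 0 m.
Proof.
apply/polyP => i; rewrite coefB coefZ coefXM !coef_halfHe !addn0 addn1 doubleS.
rewrite alpha_even alpha_odd.
case: i => [|i] /=; first by rewrite !ffactn0; ring.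
rewrite ffactS_rec natrD natrM.
have := beta0S i; move: (beta 0 i.+1) (beta 1 i) => b1 b0 h.
have -> : b0 = - (i.+1%:R * b1) by rewrite h opprK.
ring.
Qed.

Lemma halfHe1S m : halfHe 1 m.+1 = halfHe 0 m.+1 - m.+1.*2%:R *: halfHe 1 m.
Proof.
apply/polyP => i; rewrite coefB coefZ !coef_halfHe !addn0 !addn1 doubleS.
rewrite (alpha_odd m.+1) doubleS alpha_even -beta1E.
have -> : (m.*2.+2)%:R * (alpha m.*2.+1 * beta 1 i * (m ^_ i)%:R)
   = alpha m.*2.+1 * beta 1 i * (2 * (m.+1 * m ^_ i)%:R).
  by rewrite -doubleS -muln2 !natrM; ring.
rewrite -ffactSS ffactnSr natrM.
have [im|mi] := leqP i m.+1; last by rewrite ffact_small //; ring.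
rewrite natrB // -doubleS -addn1 -[i.*2.+1]addn1 !natrD -!muln2 !natrM; ring.
Qed.

Lemma HeE n : He n = 'X^(odd n) * (halfHe (odd n) n./2 \Po 'X^2).
Proof.
have step n' : He n'.+2 = 'X * He n'.+1 - n'.+1%:R *: He n' by [].
have both m : He m.*2 = halfHe 0 m \Po 'X^2 /\ He m.*2.+1 = 'X * (halfHe 1 m \Po 'X^2).
  elim: m => [|m [IH0 IH1]].
    have h d : (d < 2)%N -> halfHe d 0 = 1.
      move=> dlt; apply/polyP => i; rewrite coef_halfHe coef1.
      case: i => [|i]; last by rewrite ffact_small // mulr0.
      by case: d dlt => [|[|]] // _; rewrite /alpha /beta /= !(big_cons, big_nil) /=.
    by rewrite !h // comp_polyC mulr1.
  have e0 : He m.+1.*2 = halfHe 0 m.+1 \Po 'X^2.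
    rewrite doubleS step IH0 IH1 halfHe0S comp_polyB comp_polyM comp_polyX comp_polyZ.
    by rewrite mulrA -expr2.
  split=> //; rewrite {1}doubleS step -doubleS e0 IH1 halfHe1S comp_polyB comp_polyZ.
  by rewrite mulrBr -scalerAr doubleS.
rewrite -{1}(odd_double_half n); case: (odd n); rewrite ?add1n ?add0n.
  by rewrite (both _).2.
by rewrite (both _).1 mul1r.
Qed.

(** * Wronskians and Vandermonde determinants *)

Definition euler (d i : nat) (p : {poly rat}) : {poly rat} :=
  \poly_(m < size p) (p`_m *+ (m.*2 + d) ^_ i).

Lemma coef_euler d i p m : (euler d i p)`_m = p`_m *+ (m.*2 + d) ^_ i.
Proof. by rewrite coef_poly; case: ltnP => // mp; rewrite nth_default // mul0rn. Qed.

(* [x^i (d/dx)^i] preserves each of the two spaces [x^d Q[x^2]]; [euler d i] is the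
   operator it induces on [Q[y]], [y = x^2]. *)
Lemma derivn_euler d i p :
  'X^i * ('X^d * (p \Po 'X^2))^`(i) = 'X^d * (euler d i p \Po 'X^2).
Proof.
apply/polyP => m; rewrite !coefXnM coef_derivn coefXnM !coef_comp_poly_Xn // coef_euler.
case: ltnP => mi.
  case: ltnP => // md; case: ifP => // /dvdnP[q qE].
  by rewrite qE mulnK // -muln2 -qE ffact_small ?mulr0n //; lia.
rewrite subnKC //; case: ltnP => md; first by rewrite mul0rn.
case: ifP => [/dvdnP[q qE]|]; last by rewrite mul0rn.
by rewrite qE mulnK // -muln2 -qE subnK.
Qed.

Lemma euler_lin d i (I : finType) (c : I -> rat) (p : I -> {poly rat}) :
  euler d i (\sum_k c k *: p k) = \sum_k c k *: euler d i (p k).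
Proof.
apply/polyP => m; rewrite coef_euler !coef_sum -sumrMnl.
by apply: eq_bigr => k _; rewrite !coefZ coef_euler mulrnAr.
Qed.

Lemma euler_Xn d i j p : euler d i ('X^j * p) = 'X^j * euler (j.*2 + d) i p.
Proof.
apply/polyP => m; rewrite coef_euler !coefXnM coef_euler.
case: ltnP => mj; first by rewrite mul0rn.
by congr (_ *+ _ ^_ _); lia.
Qed.

Lemma det_scale_rows (R : comPzRingType) l (f : 'I_l -> R) (A : 'M_l) :
  \det (\matrix_(i, j) (f i * A i j)) = (\prod_i f i) * \det A.
Proof.
have -> : \matrix_(i, j) (f i * A i j) = diag_mx (\row_i f i) *m A.
  by apply/matrixP => i j; rewrite mul_diag_mx !mxE.
by rewrite det_mulmx det_diag; congr (_ * _); apply: eq_bigr => i _; rewrite mxE.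
Qed.

Lemma det_scale_cols (R : comPzRingType) l (f : 'I_l -> R) (A : 'M_l) :
  \det (\matrix_(i, j) (f j * A i j)) = (\prod_i f i) * \det A.
Proof.
rewrite -det_tr -[\det A]det_tr -det_scale_rows; congr (\det _).
by apply/matrixP => i j; rewrite !mxE.
Qed.

(** The sign is chosen before the ring and the entries, so that one reordering changes [Delta] and
    [euler_det] by the same sign. *)
Lemma det_perm_eq (T : eqType) (x0 : T) (s t : seq T) : perm_eq s t ->
  exists b : bool, forall (R : comPzRingType) (F : nat -> T -> R),
    \det (\matrix_(i < size s, j < size s) F i (nth x0 s j)) =
    (-1) ^+ b * \det (\matrix_(i < size t, j < size t) F i (nth x0 t j)).
Proof.
move=> st; have sz := perm_size st.
have /(tuple_permP (t := in_tuple t))[p sE] := st.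
exists (odd_perm p) => R F; move: sz; set n := size t => sz.
have -> : \det (\matrix_(i < size s, j < size s) F i (nth x0 s j)) =
  \det (\matrix_(i < n, j < n) F i (nth x0 s j)) by rewrite -sz.
rewrite mulrC -odd_permV -det_perm -det_mulmx -col_permE; congr (\det _).
apply/matrixP => i j; rewrite !mxE; congr (F i _).
by rewrite {1}sE -[nth _ _ _]tnth_nth tnth_mktuple (tnth_nth x0).
Qed.

(** The matrix is the unitriangular coefficient matrix of the [p i] times a Vandermonde matrix. *)
Lemma det_monic_Vandermonde (R : comNzRingType) l (p : nat -> {poly R}) (x : 'I_l -> R) :
  (forall i, p i \is monic) -> (forall i, size (p i) = i.+1) ->
  \det (\matrix_(i < l, j < l) (p i).[x j]) =
  \prod_(i < l) \prod_(j < l | (i < j)%N) (x j - x i).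
Proof.
move=> pm ps.
have -> : \matrix_(i < l, j < l) (p i).[x j] =
    (\matrix_(i < l, j < l) (p i)`_j) *m Vandermonde l (\row_j x j).
  apply/matrixP => i j; rewrite !mxE (horner_coef_wide (n := l)) ?ps //.
  by apply: eq_bigr => k _; rewrite !mxE.
rewrite det_mulmx det_Vandermonde det_trig; last first.
  apply/is_trig_mxP => i j ij; rewrite mxE nth_default // ps //.
rewrite big1 ?mul1r => [|i _]; last first.
  by rewrite mxE -[i : nat]/(i.+1.-1) -{2}(ps i) -/(lead_coef _) (monicP (pm i)).
by apply: eq_bigr => i _; apply: eq_bigr => j _; rewrite !mxE.
Qed.

Lemma det_ffact l (x : 'I_l -> nat) :
  \det (\matrix_(i < l, j < l) (x j ^_ i)%:R) =
  \prod_(i < l) \prod_(j < l | (i < j)%N) ((x j)%:R - (x i)%:R) :> rat.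
Proof.
pose p i : {poly rat} := \prod_(t <- iota 0 i) ('X - (t%:R)%:P).
rewrite -(@det_monic_Vandermonde _ l p (fun j => (x j)%:R)).
- congr (\det _); apply/matrixP => i j; rewrite !mxE /p horner_prod.
  elim: {i} (i : nat) => [|i IH]; first by rewrite big_nil.
  rewrite ffactnSr natrM IH -[i.+1]addn1 iotaD big_cat big_cons big_nil /= mulr1 add0n.
  rewrite hornerXsubC.
  (* Beyond [x j] the truncated subtraction does no harm, since [x j ^_ i] is already 0. *)
  have [ix|xi] := leqP i (x j); first by rewrite natrB.
  by rewrite -IH ffact_small ?mul0r.
- by move=> i; apply: monic_prod_XsubC.
by move=> i; rewrite size_prod_XsubC size_iota.
Qed.

Definition euler_entry (i n : nat) : {poly rat} :=
  euler (odd n) i (halfHe (odd n) n./2).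

Definition euler_det (n : seq nat) : {poly rat} :=
  \det (\matrix_(i < size n, j < size n) euler_entry i (nth 0%N n j)).

Lemma sum_nth (f : nat -> nat) (s : seq nat) :
  (\sum_(j < size s) f (nth 0 s j) = \sum_(x <- s) f x)%N.
Proof. by rewrite (big_nth 0%N) big_mkord. Qed.

(** Multiplying row [i] by [x^i] turns derivatives into [euler]; the column of each odd entry then
    gives up a factor [x]. *)
Lemma wronskian_euler_det n :
  'X^(\sum_(i < size n) i) * wronskian [seq He x | x <- n] =
  'X^(count odd n) * (euler_det n \Po 'X^2).
Proof.
rewrite /wronskian size_map -prodrXr -det_scale_rows.
have -> : count odd n = (\sum_(j < size n) odd (nth 0%N n j))%N.
  by rewrite (sum_nth odd) -sum1_count big_mkcond; apply: eq_bigr => x _; case: odd.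
rewrite -prodrXr.
rewrite -[_ \Po _]/((comp_poly 'X^2) _) -det_map_mx -det_scale_cols; congr (\det _).
apply/matrixP => i j; rewrite !mxE (nth_map 0%N) // HeE derivn_euler //.
Qed.

Lemma coefM_top (R : nzRingType) (p q : {poly R}) a b :
  (size p <= a.+1)%N -> (size q <= b.+1)%N -> (p * q)`_(a + b) = p`_a * q`_b.
Proof.
move=> pa qb; rewrite coefM.
have alt : (a < (a + b).+1)%N by rewrite ltnS leq_addr.
rewrite (bigD1 (Ordinal alt)) //= addKn big1 ?addr0 // => -[i /= ilt] ia.
have {}ia : i != a by apply: contraNneq ia => ia; apply/eqP/val_inj.
have [lt|ge] := ltnP i a.
  by rewrite [q`__]nth_default ?mulr0 // (leq_trans qb) //; lia.
by rewrite nth_default ?mul0r // (leq_trans pa) //; lia.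
Qed.

Lemma prod_top (R : comNzRingType) l (p : 'I_l -> {poly R}) (d : 'I_l -> nat) :
  (forall i, (size (p i) <= (d i).+1)%N) ->
  (size (\prod_i p i)%R <= (\sum_i d i).+1)%N /\
  (\prod_i p i)`_(\sum_i d i)%N = \prod_i (p i)`_(d i).
Proof.
move=> pd; elim: (index_enum _) => [|i s [IH1 IH2]].
  by rewrite !big_nil size_poly1 coef1.
rewrite !big_cons; split; last by rewrite coefM_top ?IH2.
rewrite (leq_trans (size_polyMleq _ _)) // -subn1 leq_subLR.
by rewrite (leq_trans (leq_add (pd i) IH1)) //; lia.
Qed.

Lemma det_top (R : comNzRingType) l (A : 'M[{poly R}]_l) (d : 'I_l -> nat) :
  (forall i j, (size (A i j) <= (d j).+1)%N) ->
  (size (\det A) <= (\sum_i d i).+1)%N /\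
  (\det A)`_(\sum_i d i)%N = \det (\matrix_(i, j) (A i j)`_(d j)).
Proof.
move=> Ad.
have perm_top (s : 'S_l) : (size (\prod_i A i (s i))%R <= (\sum_i d i).+1)%N /\
    (\prod_i A i (s i))`_(\sum_i d i)%N = \prod_i (A i (s i))`_(d (s i)).
  have -> : (\sum_i d i = \sum_i d (s i))%N by rewrite (reindex_inj (@perm_inj _ s)).
  by apply: prod_top => i.
split.
  rewrite /determinant (leq_trans (size_sum _ _ _)) //; apply/bigmax_leqP => s _.
  rewrite mulr_sign; case: ifP => _; rewrite ?size_polyN; exact: (perm_top s).1.
rewrite /determinant coef_sum; apply: eq_bigr => s _.
rewrite !mulr_sign; case: ifP => _; rewrite ?coefN (perm_top s).2 //.
  by congr (- _); apply: eq_bigr => i _; rewrite mxE.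
by apply: eq_bigr => i _; rewrite mxE.
Qed.

Lemma DeltaE n : Delta n = \det (\matrix_(i < size n, j < size n) (nth 0%N n j ^_ i)%:R).
Proof. by rewrite (det_ffact (fun j : 'I__ => nth 0%N n j)). Qed.

Lemma halfHe_monic (d m : nat) : (d < 2)%N -> (halfHe d m)`_m = 1.
Proof.
elim: m d => [|m IH] d dlt.
  rewrite coef_halfHe; case: d dlt => [|[|]] // _; by rewrite /alpha /beta /= !(big_cons, big_nil).
have h0 : (halfHe 0 m.+1)`_m.+1 = 1.
  rewrite halfHe0S coefB coefZ coefXM /= IH // nth_default ?mulr0 ?subr0 //.
  exact: size_poly.
case: d dlt => [|[|]] // _.
rewrite halfHe1S coefB coefZ h0 nth_default ?mulr0 ?subr0 //; exact: size_poly.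
Qed.

(** Since [halfHe] is monic, the coefficients of degree [n_j./2] in column [j] are the falling
    factorials of [n_j], and [DeltaE] applies. *)
Lemma euler_det_top n :
  (size (euler_det n) <= (\sum_(x <- n) x./2).+1)%N /\
  (euler_det n)`_(\sum_(x <- n) x./2)%N = Delta n.
Proof.
have [|h1 h2] := @det_top rat _
  (\matrix_(i < size n, j < size n) euler_entry i (nth 0%N n j))
  (fun j => (nth 0%N n j)./2).
  by move=> i j; rewrite mxE (leq_trans (size_poly _ _)) // size_poly.
rewrite (sum_nth half) in h1 h2; split => //.
rewrite h2 DeltaE; congr (\det _); apply/matrixP => i j; rewrite !mxE.
rewrite coef_euler halfHe_monic; last by case: odd.
by rewrite addnC odd_double_half.
Qed.

Lemma Delta_neq0 n : uniq n -> Delta n != 0.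
Proof.
move=> nu; apply/prodf_neq0 => i _; apply/prodf_neq0 => j ij.
by rewrite subr_eq0 eqr_nat nth_uniq // gtn_eqF.
Qed.

(** * Reduction on the lowest coefficients *)

(** [B] inverts the matrix [C] of the lowest [size a] coefficients, so the [j]-th combination is
    ['X^j] plus terms of degree at least [size a]. Scaling rows by [beta] and columns by [alpha]
    reduces [\det C] to a determinant of falling factorials. *)
Lemma halfHe_reduce (d : nat) (a : seq nat) : uniq a ->
  exists (B : 'M[rat]_(size a)) (r : 'I_(size a) -> {poly rat}),
    [/\ \det B * ((\prod_(x <- a) alpha (x.*2 + d)) * (\prod_(i < size a) beta d i) * Delta a) = 1,
        forall j, \sum_k B k j *: halfHe d (nth 0%N a k) = 'X^j * r j &
        forall j, (r j)`_0 = 1].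
Proof.
move=> au; pose C := \matrix_(i < size a, j < size a) (halfHe d (nth 0%N a j))`_i.
have dC : \det C = (\prod_(x <- a) alpha (x.*2 + d)) * (\prod_(i < size a) beta d i) * Delta a.
  rewrite DeltaE (big_nth 0%N) big_mkord -mulrA -det_scale_rows -det_scale_cols.
  congr (\det _).
  by apply/matrixP => i j; rewrite !mxE coef_halfHe mulrA.
have dC0 : \det C != 0.
  rewrite dC !mulf_neq0 ?Delta_neq0 //; last first.
    apply/prodf_neq0 => i _.
    by rewrite mulf_neq0 ?expf_neq0 ?invr_eq0 ?pnatr_eq0 // -lt0n fact_gt0.
  by rewrite prodf_seq_neq0; apply/allP => i _; rewrite alpha_neq0.
have Cu : C \in unitmx by rewrite unitmxE unitfE.
pose g j := \sum_k invmx C k j *: halfHe d (nth 0%N a k).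
have gE (j i : 'I_(size a)) : (g j)`_i = (i == j)%:R.
  rewrite /g coef_sum; move/matrixP: (mulmxV Cu) => /(_ i j).
  rewrite !mxE => <-; apply: eq_bigr => k _.
  by rewrite coefZ !mxE mulrC.
exists (invmx C), (fun j : 'I__ => drop_poly j (g j)); split.
- by rewrite -dC det_inv mulVf.
- move=> j; rewrite -/(g j); apply/polyP => i; rewrite coefXnM coef_drop_poly.
  case: ltnP => [ij|/subnK-> //].
  by rewrite (gE j (Ordinal (ltn_trans ij (ltn_ord j)))) -val_eqE /= ltn_eqF.
by move=> j; rewrite coef_drop_poly add0n gE eqxx.
Qed.

Lemma Delta_cons x s : Delta (x :: s) = (\prod_(y <- s) (y%:R - x%:R)) * Delta s.
Proof.
rewrite /Delta /= big_ord_recl /=; congr (_ * _).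
  rewrite big_mkcond big_ord_recl /= mul1r (big_nth 0%N) big_mkord.
  by apply: eq_bigr.
apply: eq_bigr => i _.
by rewrite big_mkcond big_ord_recl /= mul1r -big_mkcond.
Qed.

Lemma Delta_cat s t :
  Delta (s ++ t) = Delta s * Delta t * \prod_(x <- s) \prod_(y <- t) (y%:R - x%:R).
Proof.
elim: s => [|x s IH] /=.
  by rewrite big_nil mulr1 /Delta [X in X * _]big_ord0 mul1r.
by rewrite !Delta_cons IH big_cons big_cat /=; ring.
Qed.

Lemma Delta_affine c s :
  Delta [seq x.*2 + c | x <- s]%N = 2 ^+ (\sum_(i < size s) i) * Delta s.
Proof.
elim: s => [|x s IH] /=; first by rewrite /Delta !big_ord0 mulr1.
rewrite !Delta_cons IH big_ord_recr /= exprD big_map.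
have -> : \prod_(y <- s) ((y.*2 + c)%:R - (x.*2 + c)%:R) =
   2 ^+ size s * \prod_(y <- s) (y%:R - x%:R) :> rat.
  elim: s {IH} => [|y s IHs] /=; first by rewrite !big_nil mulr1.
  by rewrite !big_cons IHs exprS !natrD -!muln2 !natrM; ring.
ring.
Qed.

Lemma cross_merge a b :
  cross (merge_parities a b) =
  \prod_(x <- a) \prod_(y <- b) (y.*2.+1%:R - x.*2%:R).
Proof.
rewrite /cross /merge_parities big_cat !big_map /=.
rewrite [X in _ * X]big1 ?mulr1 => [|x]; last by rewrite odd_double.
apply: eq_big => [x|x _]; first by rewrite odd_double.
rewrite big_cat !big_map /= [X in X * _]big1 ?mul1r => [|y]; last by rewrite odd_double.
by apply: eq_bigl => y; rewrite odd_double.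
Qed.

(** Mixed pairs give [cross]. The powers of 2 from pairs of equal parity depend only on the sizes,
    so they are the same for the core. *)
Lemma Delta_merge a b :
  Delta (merge_parities a b) =
  2 ^+ (\sum_(i < size a) i) * 2 ^+ (\sum_(i < size b) i)
  * (Delta a * Delta b * cross (merge_parities a b)).
Proof.
rewrite cross_merge /merge_parities Delta_cat.
have -> : [seq x.*2 | x <- a] = [seq x.*2 + 0 | x <- a]%N by apply: eq_map => x; rewrite addn0.
have -> : [seq x.*2.+1 | x <- b] = [seq x.*2 + 1 | x <- b]%N by apply: eq_map => x; rewrite addn1.
rewrite !Delta_affine big_map.
under eq_bigr => x _.
  rewrite big_map; under eq_bigr => y _ do rewrite addn0 addn1.
over.
ring.
Qed.

Lemma alpha_merge a b : \prod_(x <- merge_parities a b) alpha x =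
  (\prod_(x <- a) alpha (x.*2 + 0)) * \prod_(x <- b) alpha (x.*2 + 1).
Proof.
rewrite big_cat !big_map /=; congr (_ * _); apply: eq_bigr => x _; first by rewrite addn0.
by rewrite addn1.
Qed.

(* The matrix of coefficients of the first [e] half-polynomials is unitriangular. *)
Lemma det_halfHe_iota (d e : nat) : (d < 2)%N ->
  (\prod_(x <- iota 0 e) alpha (x.*2 + d)) * (\prod_(i < e) beta d i)
    * Delta (iota 0 e) = 1.
Proof.
move=> dlt; rewrite DeltaE size_iota.
rewrite -[X in \prod_(x <- iota 0 X) _](subn0 e) -/(index_iota 0 e) big_mkord.
rewrite -mulrA -det_scale_rows -det_scale_cols -det_tr.
rewrite det_trig; last first.
  apply/is_trig_mxP => i j ij; rewrite !mxE nth_iota // add0n ffact_small //.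
  by rewrite !mulr0.
apply: big1 => i _; rewrite !mxE nth_iota // add0n mulrA.
by rewrite -coef_halfHe halfHe_monic.
Qed.

(** With denominators cleared, the second equation says that the constant coefficient of [R] divided
    by [Delta n] is [G n / G core], for [G s] the product of the [alpha x] divided by [cross s]. *)
Lemma euler_det_factor a b : uniq a -> uniq b ->
  let n := merge_parities a b in
  let core := merge_parities (iota 0 (size a)) (iota 0 (size b)) in
  exists R : {poly rat},
    euler_det n = 'X^(\sum_(i < size a) i + \sum_(i < size b) i) * R /\
    R`_0 * (\prod_(x <- core) alpha x) * cross n
      = (\prod_(x <- n) alpha x) * Delta n * cross core.
Proof.
move=> ua ub n core.
have [Ba [ra [dBa raE ra0]]] := halfHe_reduce 0 ua.
have [Bb [rb [dBb rbE rb0]]] := halfHe_reduce 1 ub.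
set Ka := (X in _ * X = 1) in dBa; set Kb := (X in _ * X = 1) in dBb.
pose e := size a; pose o := size b.
pose A1 := \matrix_(i < e + o, j < e) euler 0 i (halfHe 0 (nth 0%N a j)).
pose A2 := \matrix_(i < e + o, j < o) euler 1 i (halfHe 1 (nth 0%N b j)).
have detn : euler_det n = \det (row_mx A1 A2).
  rewrite /euler_det /n size_merge_parities; congr (\det _); apply/matrixP => i j.
  rewrite mxE; case: (split_ordP j) => j' ->.
    rewrite row_mxEl mxE /merge_parities nth_cat size_map /= (ltn_ord j') (nth_map 0%N) //.
    by rewrite /euler_entry odd_double doubleK.
  rewrite row_mxEr mxE /merge_parities nth_cat size_map /= ltnNge leq_addr /= addKn.
  by rewrite (nth_map 0%N) // /euler_entry /= odd_double uphalf_double.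
(* Column operations by [Ba] on the even entries and by [Bb] on the odd ones bring out the monomials
   with exponents [pw], leaving [N]. *)
pose M := block_mx (map_mx polyC Ba) 0 0 (map_mx polyC Bb).
have detM : \det M = (\det Ba * \det Bb)%:P.
  by rewrite det_ublock !det_map_mx polyCM.
pose N := row_mx (\matrix_(i < e + o, j < e) euler j.*2 i (ra j))
                 (\matrix_(i < e + o, j < o) euler (j.*2 + 1) i (rb j)).
pose pw (j : 'I_(e + o)) : nat := match split j with inl j' => j' | inr j' => j' end.
have AM : row_mx A1 A2 *m M = \matrix_(i, j) ('X^(pw j) * N i j).
  rewrite mul_row_block !mulmx0 addr0 add0r; apply/matrixP => i j; rewrite [in RHS]mxE /pw.
  case: (split_ordP j) => j' ->.
    rewrite !row_mxEl !mxE -[X in euler X](addn0 _) -euler_Xn -raE euler_lin.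
    by apply: eq_bigr => k _; rewrite !mxE mulrC mul_polyC.
  rewrite !row_mxEr !mxE -euler_Xn -rbE euler_lin.
  by apply: eq_bigr => k _; rewrite !mxE mulrC mul_polyC.
(* At 0 only the constant coefficients 1 of [ra j] and [rb j] survive, leaving the falling
   factorials of [2j] and [2j + 1], the entries of [core]. *)
have detN : (\det N)`_0 = Delta core.
  rewrite -horner_coef0 -[_.[0]]/(horner_eval 0 _) -det_map_mx DeltaE.
  rewrite size_merge_parities !size_iota; congr (\det _); apply/matrixP => i j.
  rewrite [LHS]mxE [RHS]mxE /merge_parities nth_cat size_map size_iota.
  rewrite -[LHS]/(N i j).[0] horner_coef0.
  case: (split_ordP j) => j' ->; rewrite ?row_mxEl ?row_mxEr mxE coef_euler.
    by rewrite /= (nth_map 0%N) ?size_iota // nth_iota // ra0.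
  by rewrite /= addKn (nth_map 0%N) ?size_iota // nth_iota // rb0 addn1.
(* [Ka * Kb] is the inverse of the determinant of [M]. *)
exists ((Ka * Kb) *: \det N); split.
  have := congr1 determinant AM; rewrite det_mulmx -detn detM det_scale_cols prodrXr.
  have -> : (\sum_j pw j = \sum_(i < e) i + \sum_(i < o) i)%N.
    rewrite big_split_ord; congr (_ + _)%N; apply: eq_bigr => i _; rewrite /pw.
      by rewrite -[lshift _ _]/(unsplit (inl i)) unsplitK.
    by rewrite -[rshift _ _]/(unsplit (inr i)) unsplitK.
  move=> h; rewrite -scalerAr -h [euler_det n * _]mulrC mul_polyC scalerA.
  by rewrite mulrACA [Ka * _]mulrC [Kb * _]mulrC dBa dBb mulr1 scale1r.
rewrite coefZ detN !Delta_merge !size_iota !alpha_merge.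
have h0 := det_halfHe_iota (size a) (isT : (0 < 2)%N).
have h1 := det_halfHe_iota (size b) (isT : (1 < 2)%N).
rewrite /Ka /Kb.
set s1 := 2 ^+ _; set s2 := 2 ^+ _.
set x0 := \prod_(x <- iota 0 _) _ in h0 *; set x1 := \prod_(x <- iota 0 _) _ in h1 *.
set b0 := \prod_(i < size a) _ in h0 *; set b1 := \prod_(i < size b) _ in h1 *.
set d0 := Delta _ in h0 *; set d1 := Delta _ in h1 *.
set p0 := \prod_(x <- a) _; set p1 := \prod_(x <- b) _.
(* Regrouping isolates the normalising factors of the core, equal to 1 by [h0] and [h1]; they absorb
   every [beta]. *)
transitivity ((x0 * b0 * d0) * (x1 * b1 * d1) *
   (p0 * p1 * (s1 * s2 * (Delta a * Delta b * cross n)) * cross core)).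
  by rewrite -/core; ring.
by rewrite h0 h1 !mul1r.
Qed.

(** * Value at the origin *)

Lemma perm_merge_halves n :
  perm_eq n (merge_parities [seq x./2 | x <- n & ~~ odd x] [seq x./2 | x <- n & odd x]).
Proof.
have -> : merge_parities [seq x./2 | x <- n & ~~ odd x] [seq x./2 | x <- n & odd x]
  = [seq x <- n | ~~ odd x] ++ [seq x <- n | odd x].
  rewrite /merge_parities -!map_comp; congr (_ ++ _).
    rewrite -[RHS]map_id; apply/eq_in_map => x; rewrite mem_filter => /andP[xo _] /=.
    by rewrite -[RHS]odd_double_half (negPf xo).
  rewrite -[RHS]map_id; apply/eq_in_map => x; rewrite mem_filter => /andP[xo _] /=.
  by rewrite -[RHS]odd_double_half xo.
by rewrite perm_sym perm_catC perm_filterC.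
Qed.

Lemma cross_perm s t : perm_eq s t -> cross s = cross t.
Proof.
move=> st; rewrite /cross (perm_big _ st) /=; apply: eq_bigr => x _.
by rewrite (perm_big _ st).
Qed.

Lemma cross_neq0 s : cross s != 0.
Proof.
rewrite prodf_seq_neq0; apply/allP => x _; apply/implyP => xe.
rewrite prodf_seq_neq0; apply/allP => y _; apply/implyP => yo.
by rewrite subr_eq0 eqr_nat; apply: contraNneq xe => <-.
Qed.

Lemma prod_alpha_neq0 s : \prod_(x <- s) alpha x != 0.
Proof. by rewrite prodf_seq_neq0; apply/allP => x _; rewrite alpha_neq0. Qed.

Lemma core_padding (e o k : nat) : o = (e + k)%N \/ e = (o + k).+1 ->
  exists z, perm_eq (degvec (staircase k ++ nseq z 0%N)) (merge_parities (iota 0 e) (iota 0 o)).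
Proof.
case=> ->; first by exists e.*2; apply: perm_degvec_staircase_even.
by exists o.*2.+1; apply: perm_degvec_staircase_odd.
Qed.

(** Balance of the powers of [x]: [euler_det] contributes the right-hand side, the scaling of the
    rows of the Wronskian takes away the sum over [e + o], and the size of the core remains. *)
Lemma sumn_core (e o k : nat) : o = (e + k)%N \/ e = (o + k).+1 ->
  (sumn (staircase k) + \sum_(i < e + o) i = o + (\sum_(i < e) i + \sum_(i < o) i).*2)%N.
Proof.
move=> eo; have := sumn_staircase k; have := sum_ord_tri e; have := sum_ord_tri o.
have := sum_ord_tri (e + o); move: (\sum_(i < e + o) i)%N (\sum_(i < e) i)%N (\sum_(i < o) i)%N.
by move: (sumn _) => K S T U; case: eo => ->; lia.
Qed.

Lemma signed_Hodd l e o a b : sorted geq l -> size a = e -> size b = o ->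
  perm_eq (degvec l) (merge_parities a b) ->
  \prod_(x <- merge_parities a b) alpha x =
  (-1) ^+ (sign_exp e o + uphalves l) * (Hodd l)%:R * cross (merge_parities a b).
Proof.
move=> sl ea ob lab; rewrite -(perm_big _ lab) -(cross_perm lab) -Hodd_cross //=.
by rewrite !(seq.permP lab) count_even_merge count_odd_merge ea ob.
Qed.

Theorem theorem3p1 (mu nu : seq nat) (k : nat) (lam : seq nat) :
  is_partition mu -> is_partition nu -> lam = Phi mu nu k ->
  let core := staircase k in
  exists R : {poly rat},
    [/\ R \is monic,
        size R = (sumn mu + sumn nu).+1,
        He_part lam = 'X^(sumn core) * (R \Po 'X^2),
        R.[0] != 0 &
        forall v : nat, dom_seq lam core v ->
          R.[0] = (-1) ^+ (v + (sumn lam - sumn core)./2)%N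
                  * (Hodd lam)%:R / (Hprod core)%:R].
Proof.
move=> pmu pnu lamE core.
have := Phi_degvec k pmu pnu; rewrite -lamE /= => -[slam eo lamsum].
set n := degvec lam in eo *.
set o := count odd n in eo *; set e := count _ n in eo *.
pose a := [seq x./2 | x <- n & ~~ odd x]; pose b := [seq x./2 | x <- n & odd x].
have sza : size a = e by rewrite size_map size_filter.
have szb : size b = o by rewrite size_map size_filter.
have nab : perm_eq n (merge_parities a b) := perm_merge_halves n.
have un : uniq n := degvec_uniq slam.
have : uniq (merge_parities a b) by rewrite -(perm_uniq nab).
rewrite cat_uniq => /and3P[/map_uniq ua _ /map_uniq ub].
have [R' []] := euler_det_factor ua ub; set n' := merge_parities a b in nab *.
rewrite sza szb; set t := (_ + _)%N => R'E R'0.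
have Dn0 : Delta n != 0 := Delta_neq0 un.
have Dn'0 : Delta n' != 0 by apply: Delta_neq0; rewrite -(perm_uniq nab).
(* Sorting the entries by parity multiplies [Delta] and [euler_det] by the same sign. *)
have quot : (Delta n)^-1 *: euler_det n = (Delta n')^-1 *: euler_det n'.
  have [sg sgE] := det_perm_eq 0%N nab.
  have -> : Delta n = (-1) ^+ sg * Delta n'.
    by rewrite !DeltaE (sgE _ (fun i x => (x ^_ i)%:R)).
  rewrite /euler_det sgE; case: sg {sgE}; last by rewrite !expr0 !mul1r.
  by rewrite !expr1 !mulN1r invrN scaleNr scalerN opprK.
have size_n : size n = (e + o)%N by rewrite (perm_size nab) size_merge_parities sza szb.
have size_lam : size lam = (e + o)%N by rewrite -size_n size_degvec.
have := sumn_core eo; rewrite -/core -/t => core_t.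
have half_n : (\sum_(x <- n') x./2 = t + (sumn mu + sumn nu))%N.
  have : (sumn n = (\sum_(x <- n') x./2).*2 + o)%N.
    rewrite -(perm_big _ nab) /= /o; elim: (n) => [|x s IH]; first by rewrite big_nil.
    by rewrite big_cons /= IH -{1}(odd_double_half x) doubleD; lia.
  rewrite sumn_degvec size_lam lamsum -/core.
  by move: core_t; move: (\sum_(i < e + o) i)%N (\sum_(x <- n') _)%N => S S'; lia.
have [top_size top_coef] := euler_det_top n'.
rewrite R'E half_n in top_size top_coef.
have R'top : R'`_(sumn mu + sumn nu) = Delta n'.
  by rewrite -top_coef coefXnM ltnNge leq_addr addKn.
have R'size : size R' = (sumn mu + sumn nu).+1.
  apply/eqP; rewrite eqn_leq; apply/andP; split.
    apply/leq_sizeP => m lt_m; have /leq_sizeP/(_ (t + m)%N) := top_size.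
    by rewrite coefXnM [(t + m < t)%N]ltnNge leq_addr addKn; apply; rewrite -addnS leq_add2l.
  by rewrite ltnNge; apply/negP => /leq_sizeP/(_ _ (leqnn _)) /eqP; rewrite R'top (negPf Dn'0).
have [z coreE] := core_padding eo.
have hlam := signed_Hodd slam sza szb nab; rewrite -/n' in hlam.
have := signed_Hodd (sorted_staircase_pad k z) (size_iota 0 e) (size_iota 0 o) coreE.
rewrite Hodd_pad uphalves_pad -/core => hcore.
have Hcore0 : (Hodd core)%:R != 0 :> rat.
  apply: contraTneq (prod_alpha_neq0 (merge_parities (iota 0 e) (iota 0 o))) => H0.
  by rewrite hcore H0 mulr0 mul0r eqxx.
(* [hlam] and [hcore] share [e] and [o], so [sign_exp] cancels, as do the factors [cross]; only the
   parities of [uphalves] are left in the sign. *)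
have R0 : ((Delta n')^-1 *: R').[0] =
    (-1) ^+ (uphalves lam + uphalves core) * (Hodd lam)%:R / (Hodd core)%:R.
  rewrite hornerZ horner_coef0 exprD -[(-1) ^+ uphalves core]invr_sign.
  move: R'0; rewrite hcore hlam !(exprD _ (sign_exp e o)).
  move: (signr_eq0 rat (sign_exp e o)) (signr_eq0 rat (uphalves core)).
  move: (cross_neq0 n') (cross_neq0 (merge_parities (iota 0 e) (iota 0 o))) Hcore0 Dn'0.
  move: (cross n') (cross (merge_parities _ _)) (Hodd core)%:R (Hodd lam)%:R (Delta n') (R'`_0).
  move: ((-1) ^+ uphalves core) ((-1) ^+ uphalves lam) ((-1) ^+ sign_exp e o).
  move=> sc sl s c c' h' h d r c0 c'0 h'0 d0 /negbT s0 /negbT sc0 rE.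
  have -> : r = s * sl * h * c * d * c' / (s * sc * h' * c' * c).
    by rewrite -rE -[_ * c]mulrA mulfK // !mulf_neq0.
  by field; rewrite s0 sc0 h'0 d0 c'0 c0.
exists ((Delta n')^-1 *: R'); split.
- by rewrite monicE lead_coefZ /lead_coef R'size /= R'top mulVf.
- by rewrite size_scale ?invr_eq0.
(* This is the power of [x] that scales the rows in [wronskian_euler_det]; [core_t] then balances
   the exponents. *)
- apply: (mulfI (x := 'X^(\sum_(i < size n) i))); first by rewrite expf_neq0 ?polyX_eq0.
  have -> : He_part lam = (Delta n)^-1 *: wronskian [seq He x | x <- n] by [].
  rewrite -scalerAr wronskian_euler_det -/o scalerAr -comp_polyZ quot R'E scalerAr.
  rewrite comp_polyM comp_Xn_poly -exprM !mulrA -!exprD size_n; congr ('X^_ * _).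
  by move: core_t; move: (\sum_(i < e + o) i)%N => S; lia.
- rewrite R0 !mulf_neq0 ?invr_eq0 ?signr_eq0 //.
  have := prod_alpha_neq0 n'; rewrite hlam; apply: contra => /eqP->.
  by rewrite mulr0 mul0r.
move=> v /dom_seq_sign sgn; rewrite R0 Hprod_staircase.
by rewrite -[in LHS]signr_odd -sgn signr_odd.
Qed.
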